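(* Let $G$ be a finite simple undirected graph that is non-trivial (has at least two vertices), connected, and such that every block of $G$ is isomorphic to the $5$-cycle $C_5$. Then $\chi_o(G)=5$.
   Context: All graphs are simple, finite and undirected. A block of a connected non-trivial graph is a maximal connected subgraph that has no cut vertex of its own. For a vertex $x$ of a graph $G$, $N_G(x)$ denotes the open neighborhood of $x$, i.e. the set of vertices adjacent to $x$. A $k$-coloring of $G$ is a map $\varphi: V(G)\to\{1,\ldots,k\}$ (not necessarily surjective); it is proper if every color class $\varphi^{-1}(c)$ is an independent set. A coloring $\varphi$ is odd (with respect to neighborhoods) if for every non-isolated vertex $x$ there is a color $c$ such that $|\varphi^{-1}(c)\cap N_G(x)|$ is odd. The odd chromatic number $\chi_o(G)$ is the minimum number of colors in any proper coloring of $G$ that is odd with respect to neighborhoods. *)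

(* Defs.v *)
From mathcomp Require Import all_boot.

Set Implicit Arguments.
Unset Strict Implicit.
Unset Printing Implicit Defensive.

Record sgraph := SGraph {
  vertex :> finType;
  adj : rel vertex;
  adj_sym : symmetric adj;
  adj_irrefl : irreflexive adj
}.

Definition neighborhood (G : sgraph) (x : G) : {set G} := [set y | adj x y].

(* The empty graph is not connected. *)
Definition connected (G : sgraph) : Prop :=
  0 < #|G| /\ forall x y : G, connect (@adj G) x y.

(* [v] separates two other vertices lying in the same component. *)
Definition cut_vertex (G : sgraph) (v : G) : Prop :=
  exists x y : G,
    [/\ x != v, y != v, connect (@adj G) x y
      & ~~ connect [rel a b | [&& a != v, b != v & adj a b]] x y].

Definition isomorphic (G H : sgraph) : Prop :=
  exists2 f : G -> H, bijective f & {mono f : x y / adj x y}.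

(* Subgraphs need not be induced. *)
Record subgraph (G : sgraph) := Subgraph {
  sub_vertices : {set G};
  sub_adj : rel G;
  sub_adj_sym : symmetric sub_adj;
  sub_adj_adj : forall x y, sub_adj x y -> adj x y;
  sub_adj_vertices : forall x y, sub_adj x y -> x \in sub_vertices
}.

Definition subgraph_le (G : sgraph) (H K : subgraph G) : Prop :=
  sub_vertices H \subset sub_vertices K /\ subrel (sub_adj H) (sub_adj K).

Section GraphOfSubgraph.
Variables (G : sgraph) (H : subgraph G).

Definition graph_of_adj : rel {x : G | x \in sub_vertices H} :=
  [rel x y | sub_adj H (val x) (val y)].

Fact graph_of_sym : symmetric graph_of_adj.
Proof. by move=> x y; apply: sub_adj_sym. Qed.

Fact graph_of_irrefl : irreflexive graph_of_adj.
Proof.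
by move=> x; apply/negP => /sub_adj_adj; rewrite adj_irrefl.
Qed.

Definition graph_of : sgraph := SGraph graph_of_sym graph_of_irrefl.

End GraphOfSubgraph.

Definition connected_without_cut_vertex (G : sgraph) : Prop :=
  connected G /\ forall v : G, ~ cut_vertex v.

Definition block (G : sgraph) (H : subgraph G) : Prop :=
  connected_without_cut_vertex (graph_of H) /\
  forall K : subgraph G, connected_without_cut_vertex (graph_of K) ->
    subgraph_le H K -> subgraph_le K H.

(* [ordS] is the successor modulo 5. *)
Definition C5_adj : rel 'I_5 := [rel i j | (j == ordS i) || (i == ordS j)].

Fact C5_adj_sym : symmetric C5_adj.
Proof. by move=> i j; apply: orbC. Qed.

Fact C5_adj_irrefl : irreflexive C5_adj.
Proof. by case; do 5?[case=> //]. Qed.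

Definition C5 : sgraph := SGraph C5_adj_sym C5_adj_irrefl.

Section Colorings.
Variables (G : sgraph) (k : nat).
Implicit Type phi : {ffun G -> 'I_k}.

Definition color_class phi (c : 'I_k) : {set G} := [set x | phi x == c].

Definition independent (S : {set G}) : bool :=
  [forall x in S, forall y in S, ~~ adj x y].

Definition proper_coloring phi : bool :=
  [forall c, independent (color_class phi c)].

Definition odd_coloring phi : bool :=
  [forall x, (neighborhood x != set0) ==>
    [exists c, odd #|color_class phi c :&: neighborhood x|]].

Definition odd_colorable : bool :=
  [exists phi, proper_coloring phi && odd_coloring phi].

End Colorings.

Fact odd_colorable_ex (G : sgraph) : exists k, odd_colorable G k.
Proof.
exists #|G|; apply/existsP; exists [ffun x => enum_rank x].
have cl (x z : G) :
    (z \in color_class [ffun y => enum_rank y] (enum_rank x)) = (z == x).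
  by rewrite !inE ffunE (inj_eq enum_rank_inj).
apply/andP; split.
  apply/forallP => c; rewrite -(enum_valK c).
  apply/forall_inP => x; rewrite cl => /eqP ->.
  by apply/forall_inP => y; rewrite cl => /eqP ->; rewrite adj_irrefl.
apply/forallP => x; apply/implyP => /set0Pn[y xy].
apply/existsP; exists (enum_rank y).
rewrite (_ : _ :&: _ = [set y]) ?cards1 //.
apply/setP => z; rewrite in_setI cl inE.
by case: eqP => [->|//]; rewrite xy.
Qed.

Definition odd_chromatic_number (G : sgraph) : nat :=
  ex_minn (odd_colorable_ex G).

(* Main.v *)
(* Every cycle of [G] lies in a single block, so [G] grows from one vertex by
   repeatedly attaching a pentagon v a b c d at a single vertex v already present.
   The new vertices have degree 2 when they are attached, so they see an odd
   color iff their two neighbors differ: then v, a, b, c, d have distinct colors,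
   except perhaps a and d.
   With at most 4 colors this forces a and d to agree, so attaching the pentagon
   leaves the parities at v unchanged; the initial vertex has no odd color, hence
   at every stage some vertex has none.
   With 5 colors one colors each new pentagon with 5 distinct colors, and the
   colors of a and d can be chosen so that some color stays odd around v. *)
Require Import Defs.
From mathcomp Require Import all_boot.

Set Implicit Arguments.
Unset Strict Implicit.
Unset Printing Implicit Defensive.

(** * Reachability along a relation *)

Lemma connect_homo (T U : finType) (e : rel T) (e' : rel U) (f : T -> U) :
  {homo f : x y / e x y >-> e' x y} ->
  {homo f : x y / connect e x y >-> connect e' x y}.
Proof.
move=> fe x y /connectP[p]; elim: p x => [|z p IHp] x /=; first by move=> _ ->.
by case/andP=> /fe/connect1 xz /IHp/[apply]; apply: connect_trans.
Qed.

Lemma connect_exit (T : finType) (e : rel T) (S : {set T}) x y :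
    connect e x y -> x \in S -> y \notin S ->
  exists u w, [/\ u \in S, w \notin S & e u w].
Proof.
case/connectP=> p; elim: p x => [|z p IHp] x /=.
  by move=> _ -> ->.
case/andP=> xz /IHp/[apply] IH xS yS.
by have [zS|zS] := boolP (z \in S); [apply: IH | exists x, z].
Qed.

(** * Biconnected vertex sets and blocks *)

Section Biconnected.
Variable G : sgraph.
Implicit Types (X Y Z D S : {set G}) (p : seq G).

Definition induced_adj Y x y := [&& x \in Y, y \in Y & adj x y].

Definition conn Y :=
  [forall x in Y, forall y in Y, connect (induced_adj Y) x y].

(* Deleting a set [D] with at most one vertex covers connectedness and the
   absence of cut vertices at once. *)
Definition biconn X := [forall D : {set G}, (#|D| <= 1) ==> conn (X :\: D)].

Lemma connP Y :
  reflect {in Y &, forall x y, connect (induced_adj Y) x y} (conn Y).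
Proof.
apply: (iffP forall_inP) => [H x y xY yY|H x xY]; first exact: (forall_inP (H x xY)).
by apply/forall_inP => y yY; apply: H.
Qed.

Lemma biconnP X :
  reflect (forall D : {set G}, #|D| <= 1 -> conn (X :\: D)) (biconn X).
Proof.
by apply: (iffP forallP) => H D; [move: (H D) => /implyP | apply/implyP/H].
Qed.

Lemma induced_adj_sym Y : symmetric (induced_adj Y).
Proof. by move=> x y; rewrite /induced_adj adj_sym andbCA. Qed.

Lemma induced_connect_sym Y : connect_sym (induced_adj Y).
Proof. exact/sym_connect_sym/induced_adj_sym. Qed.

Lemma induced_connectS Y Z : Y \subset Z ->
  subrel (connect (induced_adj Y)) (connect (induced_adj Z)).
Proof.
move=> /subsetP YZ; apply: connect_sub => x y /and3P[/YZ xZ /YZ yZ xy].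
by apply: connect1; rewrite /induced_adj xZ yZ.
Qed.

Lemma connect_path Y x p : path (@adj G) x p -> {subset x :: p <= Y} ->
  connect (induced_adj Y) x (last x p).
Proof.
elim: p x => [|z p IHp] x //= /andP[xz zp] sY.
apply: connect_trans (IHp z zp _); last by move=> w wp; apply: sY; rewrite inE wp orbT.
by apply: connect1; rewrite /induced_adj xz !sY ?inE ?eqxx ?orbT.
Qed.

Lemma conn_path Y x y : conn Y -> x \in Y -> y \in Y ->
  exists p, [/\ path (@adj G) x p, uniq (x :: p), y = last x p
              & {subset x :: p <= Y}].
Proof.
move=> /connP cY xY yY; have /connectP[p0 + ->] := cY _ _ xY yY.
case/shortenP=> p pth up _.
exists p; split=> //; first by apply: sub_path pth => a b /and3P[].
elim: p x xY pth {up yY} => [|z p IHp] x xY /=; first by move=> _ w; rewrite inE => /eqP->.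
case/andP=> /and3P[_ zY _] /(IHp z zY) sub w.
by rewrite inE => /predU1P[->|/sub].
Qed.

Lemma clique_conn Y : {in Y &, forall x y, x != y -> adj x y} -> conn Y.
Proof.
move=> cl; apply/connP => x y xY yY.
by have [->//|/cl xy] := eqVneq x y; apply: connect1; rewrite /induced_adj xY yY xy.
Qed.

Lemma edge_biconn u w : adj u w -> biconn [set u; w].
Proof.
move=> uw; apply/biconnP => D _; apply: clique_conn => x y.
rewrite !inE => /andP[_ /orP[]/eqP->] /andP[_ /orP[]/eqP->]; rewrite ?eqxx //.
by rewrite adj_sym.
Qed.

(* A vertex z of the ear reaches one of its ends inside the ear: the deleted
   vertex can only be on one side of z. *)
Lemma ear_biconn X x p y : biconn X -> x \in X -> y \in X -> x != y ->
    path (@adj G) x (rcons p y) -> uniq p -> {in p, forall z, z \notin X} ->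
  biconn (X :|: [set z in p]).
Proof.
move=> /biconnP cX xX yX xy pth up pX; apply/biconnP => D D1.
set Y := _ :\: D; have XY : X :\: D \subset Y by rewrite setSD ?subsetUl.
have Dinj := card_le1_eqP D1.
have subY s : {subset s <= x :: rcons p y} -> {in s, forall z, z \notin D} ->
    {subset s <= Y}.
  move=> sub sD z zs; rewrite !inE sD //=.
  by have := sub z zs; rewrite inE mem_rcons inE => /or3P[/eqP->|/eqP->|->];
     rewrite ?xX ?yX ?orbT.
have uq : uniq (x :: rcons p y).
  rewrite /= mem_rcons inE negb_or xy rcons_uniq up andbT /=.
  by apply/andP; split; apply/negP => /pX; rewrite ?xX ?yX.
have toX z : z \in Y ->
    exists2 w, w \in X :\: D & connect (induced_adj Y) z w.
  rewrite 3!inE => /andP[zD /orP[zX|]]; first by exists z; rewrite // inE zD.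
  move=> zp.
  have zy : z \in rcons p y by rewrite mem_rcons inE zp orbT.
  have lastq := last_rcons x p y.
  case/splitPr: zy pth uq subY lastq => q1 q2 pth uq subY lastq.
  have zq2 : {subset z :: q2 <= x :: q1 ++ z :: q2}.
    by move=> w wq; rewrite inE mem_cat wq !orbT.
  have q1z : {subset rcons (x :: q1) z <= x :: q1 ++ z :: q2}.
    by move=> w; rewrite -cat_cons -cat_rcons mem_cat => ->.
  have [/hasP[d dq dD]|/hasPn q2D] := boolP (has (mem D) q2).
    have q1D : {in rcons (x :: q1) z, forall w, w \notin D}.
      move=> w wq; apply/negP => wD; move: uq.
      rewrite -cat_cons -cat_rcons cat_uniq => /and3P[_ /hasPn/(_ d dq)/negP[]].
      by rewrite /= (Dinj w d wD dD).
    exists x; first by rewrite inE xX q1D // mem_head.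
    have := @connect_path Y x (rcons q1 z); rewrite last_rcons induced_connect_sym.
    apply; last exact: subY q1z q1D.
    by move: pth; rewrite -cat_rcons cat_path => /andP[].
  have zq2D : {in z :: q2, forall w, w \notin D}.
    by move=> w; rewrite inE => /predU1P[->//|/q2D].
  move: lastq; rewrite last_cat /= => lastq; exists y.
    by rewrite inE yX andbT zq2D // -lastq mem_last.
  rewrite -lastq; apply: connect_path; last exact: subY zq2 zq2D.
  by move: pth; rewrite cat_path /= => /and3P[].
apply/connP => z z' /toX[w wX zw] /toX[w' w'X zw'].
apply: connect_trans zw _; rewrite induced_connect_sym.
apply: connect_trans zw' _; apply: induced_connectS XY _ _ _.
by have /connP := cX D D1; apply.
Qed.

Definition bicomp X := maxset biconn X.

(** A path that left [X] and came back would contain an ear of [X]; adding the ear keeps the set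
    biconnected, against maximality. *)
Lemma path_in_bicomp X x p : bicomp X -> x \in X -> path (@adj G) x p ->
  uniq (x :: p) -> last x p \in X -> {subset p <= X}.
Proof.
move=> mX; have [bX maxX] := maxsetP mX.
elim: p x => // s p IHp x xX pth uxp lX.
have [sX|sX] := boolP (s \in X).
  move: pth uxp => /= /andP[_ pth] /andP[_ up] w.
  by rewrite inE => /predU1P[->//|]; apply: IHp pth up lX w.
exfalso.
have hasX : has (mem X) (s :: p).
  by apply/hasP; exists (last s p); first exact: mem_last.
have sX' : head x (s :: p) \notin X by [].
(* [y] is the first vertex of the path back in [X]. The stretch [h :: q] before it is nonempty,
   since the path starts outside [X], and forms an ear from [x] to [y]. *)
case/split_find: hasX pth uxp sX' {lX sX} => y [|h q] q' yX /hasPn qX; first by rewrite /= (yX : y \in X).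
rewrite cat_path => /andP[pth _]; rewrite -cat_cons cat_uniq => /andP[/= /andP[xq uq] _] hX.
have xy : x != y by apply: contraNneq xq => ->; rewrite inE mem_rcons mem_head orbT.
have uq' : uniq (h :: q) by move: uq; rewrite -[_ && _]/(uniq (rcons (h :: q) y)) rcons_uniq => /andP[].
have := maxX _ (ear_biconn bX xX yX xy pth uq' qX) (subsetUl _ _).
by move/setP/(_ h); rewrite !inE eqxx orbT (negPf hX).
Qed.

Lemma bicomp_exists D : biconn D -> exists2 X, bicomp X & D \subset X.
Proof. by case/maxset_exists=> X; exists X. Qed.

Definition induced Y : subgraph G.
Proof.
apply: (@Subgraph G Y (induced_adj Y)); first exact: induced_adj_sym.
- by move=> x y /and3P[].
- by move=> x y /and3P[].
Defined.

(** Deleting [set0] gives connectedness, deleting a singleton excludes a cut vertex. Nonemptiness is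
    required because the empty set can be biconnected but is not a connected graph. *)
Lemma bicomp_block X : X != set0 -> bicomp X -> block (induced X).
Proof.
case/set0Pn=> x0 x0X /maxsetP[/biconnP bX maxX].
pose s0 : graph_of (induced X) := Sub x0 x0X.
(* Walks inside [X] are carried to the subtype by [insubd]; its default [s0] is never reached on
   [X]. *)
have val_insubd y : y \in X -> val (insubd s0 y) = y by move=> yX; rewrite insubdK.
split; first split; first split.
- by apply/card_gt0P; exists s0.
- move=> x y; have := bX set0; rewrite cards0 setD0 => /(_ isT)/connP/(_ _ _ (valP x) (valP y)).
  move/(@connect_homo _ _ _ (@adj (graph_of (induced X))) (insubd s0)).
  rewrite !valKd; apply=> a b /and3P[aX bX' ab].
  by rewrite /= /graph_of_adj /= /induced_adj !val_insubd // aX bX'.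
- move=> v [x [y [xv yv _ /negP[]]]].
  have := bX [set val v]; rewrite cards1 => /(_ isT)/connP/(_ (val x) (val y)).
  rewrite !inE !val_eqE xv yv => /(_ (valP x) (valP y)).
  move/(@connect_homo _ _ _ [rel a b | [&& a != v, b != v & adj a b]] (insubd s0)).
  rewrite !valKd; apply=> a b /and3P[/setD1P[av aX] /setD1P[bv bX'] ab] /=.
  rewrite /graph_of_adj /= /induced_adj !val_insubd // aX bX' ab.
  by rewrite -!val_eqE /= !val_insubd // av bv.
move=> K [[_ cK] nK] [XK _].
have bK : biconn (sub_vertices K).
  apply/biconnP => D D1; apply/connP => x y.
  move=> /setDP[xK xD] /setDP[yK yD].
  pose x' : graph_of K := Sub x xK; pose y' : graph_of K := Sub y yK.
  have xy' : connect (@adj (graph_of K)) x' y' by [].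
  (* [D] removes either a single vertex [v] of [K], which is not a cut vertex, or no vertex of [K]
     at all. *)
  have [/existsP[v vD]|/existsPn KD] := boolP [exists v : graph_of K, val v \in D].
    have DE a : (val a \in D) = (a == v).
      apply/idP/eqP => [aD|->//]; apply: val_inj.
      by have /card_le1_eqP := D1; apply.
    rewrite -[x]/(val x') -[y]/(val y').
    have := @connect_homo _ _ [rel a b | [&& a != v, b != v & adj a b]]
      (induced_adj (sub_vertices K :\: D)) val; apply.
      move=> a b /= /and3P[av bv /sub_adj_adj ab].
      by rewrite /induced_adj !inE !DE av bv (valP a) (valP b).
    apply/negP => /negP nxy; apply: (nK v); exists x', y'; split=> //.
      by rewrite -DE.
    by rewrite -DE.
  rewrite -[x]/(val x') -[y]/(val y').
  apply: (connect_homo _ xy') => a b /= /sub_adj_adj ab.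
  by rewrite /induced_adj !inE !KD (valP a) (valP b).
have eqX := maxX _ bK XK.
split; first by rewrite eqX.
move=> a b ab; rewrite /= /induced_adj -eqX (sub_adj_adj ab).
by rewrite (sub_adj_vertices ab) (@sub_adj_vertices _ _ b a) // sub_adj_sym.
Qed.

End Biconnected.

(** * Induced pentagons and trees of pentagons *)

Section Pentagons.
Variable G : sgraph.
Implicit Types (X S : {set G}) (p : seq G).

(** The vertices come in cyclic order. The last conjunct excludes all five chords, so each vertex
    has exactly two neighbors on the cycle. The relation is a parameter so as to serve both [C5] and
    [G]. *)
Definition pentagon (T : eqType) (e : rel T) (u w a b c : T) : bool :=
  [&& uniq [:: u; w; a; b; c],
      [&& e u w, e w a, e a b, e b c & e c u]
    & ~~ [|| e u a, e u b, e w b, e w c | e a c]].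

Lemma C5_pentagon (i j : C5) : adj i j ->
  exists k l m, pentagon (@adj C5) i j k l m /\ forall n, n \in [:: i; j; k; l; m].
Proof.
(* [s] is the rotation that takes [i] to [j], in whichever direction the edge runs; iterating it
   from [j] lists the other three vertices. *)
pose s : C5 -> C5 := if j == ordS i then @ordS 5 else @ord_pred 5.
move=> ij; exists (s j), (s (s j)), (s (s (s j))); move: ij; rewrite {}/s.
case: i j => [[|[|[|[|[|//]]]]] hi] [[|[|[|[|[|//]]]]] hj] //= _; split=> //.
all: by case=> [[|[|[|[|[|//]]]]] hn].
Qed.

Lemma isomorphic_C5_pentagon X u w : isomorphic (graph_of (induced X)) C5 ->
    u \in X -> w \in X -> adj u w ->
  exists a b c, pentagon (@adj G) u w a b c /\ X =i [:: u; w; a; b; c].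
Proof.
move=> [f [g fK gK] f_adj] uX wX uw.
pose u' : graph_of (induced X) := Sub u uX.
pose w' : graph_of (induced X) := Sub w wX.
pose h i : G := val (g i).
have h_inj : injective h by move=> i j /val_inj/(can_inj gK).
have h_adj i j : adj (h i) (h j) = adj i j.
  rewrite -{2}(gK i) -{2}(gK j) f_adj /= /graph_of_adj /= /induced_adj.
  by rewrite (valP (g i)) (valP (g j)).
have hu : h (f u') = u by rewrite /h fK.
have hw : h (f w') = w by rewrite /h fK.
have /C5_pentagon[k [l [m [pent all5]]]] : adj (f u') (f w').
  by rewrite -h_adj hu hw.
exists (h k), (h l), (h m); split.
  by move: pent; rewrite /pentagon -hu -hw !h_adj -!(map_inj_uniq h_inj).
rewrite -hu -hw => z; apply/idP/idP => [zX|].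
  have -> : z = h (f (Sub z zX)) by rewrite /h fK.
  by rewrite (mem_map h_inj [:: _; _; k; l; m]).
by rewrite !inE => /or4P[||| /orP[]] /eqP->; apply: valP.
Qed.

Record attached_pentagon S v a b c d : Prop := AttachedPentagon {
  attached_root : v \in S;
  attached_new : {in [:: a; b; c; d], forall y, y \notin S};
  attached_pent : pentagon (@adj G) v a b c d;
  attached_only : {in S & [:: a; b; c; d], forall x y, adj x y -> x = v}
}.

Inductive pentagon_tree : {set G} -> Prop :=
| pentagon_tree1 r : pentagon_tree [set r]
| pentagon_treeU S v a b c d : pentagon_tree S ->
    attached_pentagon S v a b c d ->
    pentagon_tree (S :|: [set y in [:: a; b; c; d]]).

End Pentagons.

(** * Exhausting the graph by attaching one block at a time *)

Section Growth.
Variable G : sgraph.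
Hypothesis hconn : connected G.
Hypothesis hblocks : forall H : subgraph G, block H -> isomorphic (graph_of H) C5.
Implicit Types (X S : {set G}) (p : seq G).

Lemma bicomp_pentagon X u w : bicomp X -> u \in X -> w \in X -> adj u w ->
  exists a b c, pentagon (@adj G) u w a b c /\ X =i [:: u; w; a; b; c].
Proof.
move=> mX uX; apply: (isomorphic_C5_pentagon _ uX); apply/hblocks/(bicomp_block _ mX).
by apply/set0Pn; exists u.
Qed.

(** [Y] is a pentagon through the edge [u w]; the rest of it is a path from [w] back to [u], with
    both ends in [X], so [X] absorbs it. *)
Lemma bicomp_edge_sub X Y u w : bicomp X -> bicomp Y -> adj u w ->
  u \in X -> w \in X -> u \in Y -> w \in Y -> Y \subset X.
Proof.
move=> mX mY uw uX wX uY wY.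
have [a [b [c [/and3P[un /and5P[_ wa ab bc cu] _] YE]]]] := bicomp_pentagon mY uY wY uw.
have pX : {subset [:: a; b; c; u] <= X}.
  have lX : last w [:: a; b; c; u] \in X by [].
  apply: (path_in_bicomp mX wX _ _ lX); first by rewrite /= wa ab bc cu.
  by rewrite (rot_uniq 1 [:: u; w; a; b; c]).
apply/subsetP => z; rewrite YE inE => /predU1P[->//|]; rewrite inE.
case/predU1P=> [->//|zp]; apply: pX; move: zp; rewrite !inE => /or3P[]->; rewrite ?orbT //.
Qed.

Lemma conn_attach S X v : conn S -> conn X -> v \in S -> v \in X -> conn (S :|: X).
Proof.
move=> cS cX vS vX; apply/connP.
have toV z : z \in S :|: X -> connect (induced_adj (S :|: X)) z v.
  case/setUP=> zZ.
    by apply: induced_connectS (subsetUl S X) _ _ _; apply: (connP _ cS).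
  by apply: induced_connectS (subsetUr S X) _ _ _; apply: (connP _ cX).
move=> x y /toV xv /toV; rewrite induced_connect_sym; exact: connect_trans xv.
Qed.

(** The growth invariant: a block sharing an edge with [S] has already been added whole. It forces a
    new block to meet a connected [S] in at most one vertex. *)
Definition bicomp_closed S := forall X x y, bicomp X -> x \in X -> y \in X ->
  x \in S -> y \in S -> adj x y -> X \subset S.

Lemma bicomp_conn X : bicomp X -> conn X.
Proof. by case/maxsetP=> /biconnP/(_ set0) + _; rewrite cards0 setD0; apply. Qed.

(** A second common vertex [w] would be joined to [v] by a path inside [S]. That path stays in [X],
    so its first edge lies in both sets, and closedness would put [a] in [S]. *)
Lemma bicomp_closedI S X v a : conn S -> bicomp_closed S -> bicomp X ->
  v \in S -> a \notin S -> v \in X -> a \in X -> {in S, forall w, w \in X -> w = v}.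
Proof.
move=> cS clS mX vS aS vX aX w wS wX; apply/eqP/negPn/negP => wv.
have [[|s p] [pth up lp sub]] := conn_path cS vS wS; first by rewrite lp eqxx in wv.
have sX : s \in X.
  apply: (path_in_bicomp mX vX pth up); last exact: mem_head.
  by rewrite -lp.
have sS : s \in S by apply: sub; rewrite !inE eqxx orbT.
have /andP[vs _] := pth.
by have /subsetP/(_ a aX) := clS X v s mX vX sX vS sS vs; rewrite (negPf aS).
Qed.

(** Going from [y] to [x] and then through [S] to [v] is a path with both ends in [X], hence
    contained in [X]. *)
Lemma bicomp_attach S X v y x : conn S -> bicomp X -> v \in S -> v \in X ->
  y \in X -> y \notin S -> x \in S -> adj x y -> x \in X.
Proof.
move=> cS mX vS vX yX yS xS xy.
have [p [pth up lp sub]] := conn_path cS xS vS.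
apply: (path_in_bicomp mX yX _ _ _ (mem_head x p)) => /=.
- by rewrite adj_sym xy.
- by move: up => /= ->; rewrite andbT; apply: contra yS; apply: sub.
- by rewrite -lp.
Qed.

(** Some edge [v a] leaves [S]; the block containing it meets [S] only in [v], and is the next
    pentagon. *)
Lemma pentagon_tree_grow S : pentagon_tree S -> conn S -> bicomp_closed S ->
  S != setT -> S != set0 ->
  exists2 S' : {set G}, S \proper S' & [/\ pentagon_tree S', conn S' & bicomp_closed S'].
Proof.
move=> tS cS clS; rewrite -properT => /properP[_ [z _ zS]] /set0Pn[r rS].
have [v [a [vS aS va]]] := connect_exit (hconn.2 r z) rS zS.
have [X mX] := bicomp_exists (edge_biconn va).
rewrite subUset !sub1set => /andP[vX aX].
have SX := bicomp_closedI cS clS mX vS aS vX aX.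
have [b [c [d [pent XE]]]] := bicomp_pentagon mX vX aX va.
have only : {in S & X, forall x y, y \notin S -> adj x y -> x = v}.
  move=> x y xS yX yS xy; apply: (SX) => //.
  exact: bicomp_attach cS mX vS vX yX yS xS xy.
have newX y : y \in [:: a; b; c; d] -> y \in X.
  by move=> yn; rewrite XE inE yn orbT.
have new y : y \in [:: a; b; c; d] -> y \notin S.
  move=> yn; apply/negP => yS; have yv := SX y yS (newX y yn); rewrite yv in yn.
  by move: pent; rewrite /pentagon cons_uniq yn.
have EX : S :|: [set y in [:: a; b; c; d]] = S :|: X.
  apply/setP => y; rewrite !in_setU inE XE [in RHS]inE.
  by case: eqP => [->|//]; rewrite vS.
exists (S :|: [set y in [:: a; b; c; d]]).
  by rewrite EX properE subsetUl; apply/subsetPn; exists a; rewrite // inE aX orbT.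
split.
- apply: (pentagon_treeU tS (v := v)); split=> // x y xS yn.
  by apply: only => //; [apply: newX | apply: new].
- by rewrite EX; apply: conn_attach cS (bicomp_conn mX) vS vX.
rewrite EX => Y x y mY xY yY.
(* An edge of the union lies within [S] or within [X], as an edge from [S] to a new vertex starts at
   [v]. The first case is the old invariant, the second is [bicomp_edge_sub]. *)
have [xS|xS] := boolP (x \in S); have [yS|yS] := boolP (y \in S).
- by move=> _ _ xy; apply: subset_trans (clS _ _ _ mY xY yY xS yS xy) (subsetUl _ _).
- rewrite !inE (negPf yS) => _ /= yX xy.
  have xv := only x y xS yX yS xy; rewrite xv in xy xY.
  exact: subset_trans (bicomp_edge_sub mX mY xy vX yX xY yY) (subsetUr _ _).
- rewrite !inE (negPf xS) /= => xX _; rewrite adj_sym => yx.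
  have yv := only y x yS xX xS yx; rewrite yv in yx yY.
  exact: subset_trans (bicomp_edge_sub mX mY yx vX xX yY xY) (subsetUr _ _).
rewrite !inE (negPf xS) (negPf yS) /= => xX yX xy.
exact: subset_trans (bicomp_edge_sub mX mY xy xX yX xY yY) (subsetUr _ _).
Qed.

Lemma pentagon_tree_setT : pentagon_tree [set: G].
Proof.
have [/card_gt0P[r _] _] := hconn.
have base : [/\ pentagon_tree [set r], conn [set r] & bicomp_closed [set r]].
  split; first exact: pentagon_tree1.
    by apply: clique_conn => x y /set1P-> /set1P->; rewrite eqxx.
  by move=> X x y _ _ _ /set1P-> /set1P->; rewrite adj_irrefl.
have rS := set11 r.
(* Induction on a strict bound for the number of vertices not yet reached. *)
move: {2}#|_|.+1 (ltnSn #|~: [set r]|) rS base => n.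
elim: n [set r] => // n IHn S nS rS [tS cS clS].
have [<-//|ST] := eqVneq S setT.
have S0 : S != set0 by apply/set0Pn; exists r.
have [S' SS' [tS' cS' clS']] := pentagon_tree_grow tS cS clS ST S0.
apply: (IHn S') => //; last by have [/subsetP-> //] := properP SS'.
by rewrite -ltnS; apply: leq_trans nS; rewrite ltnS proper_card // properC.
Qed.

End Growth.

(** * Parities of the colors around a vertex *)

Section NeighborCounts.
Variables (G : sgraph) (k : nat).
Implicit Types (S : {set G}) (f : G -> 'I_k).

(** Only neighbors inside [S] count, so parities can be followed while [S] grows; a sum of booleans
    splits over disjoint unions. *)
Definition nbr_count f S x i := \sum_(y in S) (adj x y && (f y == i)).

Definition odd_at f S x := [exists i, odd (nbr_count f S x i)].

Lemma eq_nbr_count f g S x i :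
  {in S, f =1 g} -> nbr_count f S x i = nbr_count g S x i.
Proof. by move=> fg; apply: eq_bigr => y yS; rewrite fg. Qed.

Lemma eq_odd_at f g S T x :
  (forall i, odd (nbr_count f S x i) = odd (nbr_count g T x i)) ->
  odd_at f S x = odd_at g T x.
Proof. by move=> e; apply: eq_existsb. Qed.

Lemma exists_odd_pair (p q : 'I_k) : [exists i, odd ((p == i) + (q == i))] = (p != q).
Proof.
apply/existsP/idP => [[i]|pq]; first by apply: contraTneq => ->; rewrite oddD addbb.
by exists p; rewrite eqxx eq_sym (negPf pq).
Qed.

Section Attach.
Variables (f : G -> 'I_k) (S : {set G}) (v a b c d : G).
Hypothesis att : attached_pentagon S v a b c d.
Let S' := S :|: [set y in [:: a; b; c; d]].

Lemma nbr_count_attach x i : nbr_count f S' x i =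
  nbr_count f S x i + \sum_(y <- [:: a; b; c; d]) (adj x y && (f y == i)).
Proof.
have [_ new /andP[/andP[_ un] _] _] := att.
rewrite /nbr_count (eq_bigl [in [predU S & [:: a; b; c; d]]]); last first.
  by move=> y; rewrite in_setU [y \in [set _ | _]]inE.
rewrite bigU /=; first by rewrite [in RHS]big_uniq.
by rewrite disjoint_sym disjoint_subset; apply/subsetP => y /new.
Qed.

Lemma nbr_count_old x i : x \in S -> x != v -> nbr_count f S' x i = nbr_count f S x i.
Proof.
move=> xS xv; rewrite nbr_count_attach [X in _ + X]big1_seq ?addn0 // => y /andP[_ yn].
by case: (boolP (adj x y)) => // /(attached_only att xS yn) xv'; rewrite xv' eqxx in xv.
Qed.

Lemma nbr_count_new y i : y \in [:: a; b; c; d] ->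
  nbr_count f S y i = adj y v && (f v == i).
Proof.
move=> yn; rewrite /nbr_count (bigD1 v) ?(attached_root att) //= big1 ?addn0 // => x.
case/andP=> xS xv; case: (boolP (adj y x)) => //; rewrite adj_sym.
by move/(attached_only att xS yn) => xv'; rewrite xv' eqxx in xv.
Qed.

Lemma nbr_count_root i :
  nbr_count f S' v i = nbr_count f S v i + ((f a == i) + (f d == i)).
Proof.
have /and3P[_ /and5P[va _ _ _ dv]] := attached_pent att.
rewrite !negb_or => /and5P[vb vc _ _ _].
rewrite nbr_count_attach !big_cons big_nil va (negPf vb) (negPf vc).
by rewrite (adj_sym v d) dv !addn0.
Qed.

(** Each new vertex has just its two pentagon neighbors in [S']: the chords are absent, and [v] is
    the only old vertex adjacent to a new one. So [exists_odd_pair] applies. *)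
Lemma odd_at_new : [/\ odd_at f S' a = (f v != f b), odd_at f S' b = (f a != f c),
  odd_at f S' c = (f b != f d) & odd_at f S' d = (f v != f c)].
Proof.
have /and3P[_ /and5P[va ab bc cd dv]] := attached_pent att.
rewrite !negb_or => /and5P[vb vc ac ad bd].
have E : (adj a v = true) * (adj b a = true) * (adj c b = true) * (adj d c = true)
  * (adj b v = false) * (adj c v = false)
  * (adj c a = false) * (adj d a = false) * (adj d b = false).
  by do !split; rewrite // adj_sym //; apply: negPf.
split; rewrite -exists_odd_pair; apply: eq_existsb => i;
  rewrite nbr_count_attach nbr_count_new ?inE ?eqxx ?orbT // !big_cons big_nil
    ?adj_irrefl ?E ?ab ?bc ?cd ?dv ?(negPf vb) ?(negPf vc) ?(negPf ac) ?(negPf ad) ?(negPf bd);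
  by rewrite ?addn0 ?add0n.
Qed.

End Attach.
End NeighborCounts.

(** * Four colors do not suffice *)

Lemma pentagon_tree_not_odd (G : sgraph) k (f : G -> 'I_k) (S : {set G}) :
    k <= 4 -> (forall x y, adj x y -> f x != f y) -> pentagon_tree S ->
  exists2 x, x \in S & ~~ odd_at f S x.
Proof.
move=> k4 f_proper; elim=> {S} [r|S v a b c d _ [x xS xodd] att].
  exists r; rewrite ?set11 // negb_exists; apply/forallP => i.
  by rewrite /nbr_count big_set1 adj_irrefl.
(* Assuming that every vertex of [S'] sees an odd color, the old exceptional vertex [x] is shown to
   see one in [S] already. *)
set S' := _ :|: _; apply/exists_inP; apply: contraT => none.
have S'odd y : y \in S' -> odd_at f S' y.
  move=> yS'; have [//|ny] := boolP (odd_at f S' y).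
  by case/negP: none; apply/exists_inP; exists y.
have odd_new y : y \in [:: a; b; c; d] -> odd_at f S' y.
  by move=> yn; apply: S'odd; rewrite in_setU inE yn orbT.
have /and3P[_ /and5P[/f_proper va /f_proper ab /f_proper bc /f_proper cd /f_proper dv] _]
  := attached_pent att.
have [oa ob oc od] := odd_at_new f att.
(* Adjacency and the odd colors at the new vertices separate every pair of the five colors except
   that of [a] and [d]; if these differed too, there would be five colors. *)
have fad : f a = f d.
  apply/eqP/negPn/negP => ad.
  have : uniq [:: f v; f a; f b; f c; f d].
    rewrite /= !inE !negb_or va ab bc cd ad (eq_sym (f v) (f d)) dv.
    by rewrite -oa -od -ob -oc !odd_new ?inE ?eqxx ?orbT.
  move/card_uniqP=> /= card5; have := max_card (mem [:: f v; f a; f b; f c; f d]).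
  by rewrite card5 card_ord => /leq_trans/(_ k4).
(* With [a] and [d] colored alike, the counts at [v] change by 0 or 2, and those at other old
   vertices not at all. *)
case/negP: xodd; rewrite -(@eq_odd_at _ _ f f S'); last first.
  move=> i; have [->|xv] := eqVneq x v; last by rewrite (nbr_count_old _ att).
  by rewrite (nbr_count_root _ att) fad addnn oddD odd_double addbF.
by apply: S'odd; rewrite in_setU xS.
Qed.

(** * A coloring with five colors *)

Lemma C5_colors (i : 'I_5) : uniq [:: i; ordS i; ordS (ordS i); ordS (ordS (ordS i));
  ordS (ordS (ordS (ordS i)))].
Proof. by case: i => [[|[|[|[|[|//]]]]] hi]. Qed.

(** Here [i] is the color of the root, [o] marks the colors odd around it so far, and [p], [s] are
    meant for its two new neighbors. *)
Lemma pentagon_colors (i : 'I_5) (o : pred 'I_5) : exists p q r s,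
  uniq [:: i; p; q; r; s] /\ [exists j, o j (+) odd ((p == j) + (s == j))].
Proof.
have := C5_colors i.
set p := ordS i; set q := ordS p; set r := ordS q; set s := ordS r => un.
have [pq ps] : p != q /\ p != s.
  by move: un => /and3P[_ + _]; rewrite !inE !negb_or => /and3P[].
(* If color [p] is even at the root, using it on exactly one new neighbor makes it odd; if it is
   odd, using it on neither keeps it so. *)
have [op|op] := boolP (o p); last first.
  exists p, q, r, s; split=> //; apply/existsP; exists p.
  by rewrite (negPf op) eqxx (eq_sym s) (negPf ps).
exists q, p, r, s; split; last first.
  by apply/existsP; exists p; rewrite op (eq_sym s) (eq_sym q) (negPf pq) (negPf ps).
rewrite (perm_uniq (s2 := [:: i; p; q; r; s])) // perm_cons.
by rewrite (perm_catCA [:: q] [:: p] [:: r; s]).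
Qed.

(** The guard [1 < #|S|] is there for the initial single vertex, which has no neighbor and hence no
    odd color. *)
Lemma pentagon_tree_colorable (G : sgraph) (S : {set G}) : pentagon_tree S ->
  exists f : G -> 'I_5, {in S &, forall x y, adj x y -> f x != f y} /\
    (1 < #|S| -> {in S, forall x, odd_at f S x}).
Proof.
elim=> {S} [r|S v a b c d _ [f [f_proper f_odd]] att].
  exists (fun=> ord0); split; last by rewrite cards1.
  by move=> x y /set1P-> /set1P->; rewrite adj_irrefl.
have [p [q [r [s [un ps]]]]] := pentagon_colors (f v) (fun j => odd (nbr_count f S v j)).
have [vS new pent only] := att.
pose g y := if y \in S then f y else if y == a then p else if y == b then q
  else if y == c then r else s.
have gS : {in S, g =1 f} by move=> y yS; rewrite /g yS.
have gv := gS v vS.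
have g_new : [:: g v; g a; g b; g c; g d] = [:: f v; p; q; r; s].
  have [+ _ _] := and3P pent; rewrite /= !inE !negb_or.
  move=> /and5P[_ /and3P[ab ac ad] /andP[bc bd] cd _].
  rewrite gv /g !(negPf (new _ _)) ?inE ?eqxx ?orbT //.
  rewrite (eq_sym b a) (eq_sym c a) (eq_sym d a) (eq_sym c b) (eq_sym d b) (eq_sym d c).
  by rewrite !(negPf ab, negPf ac, negPf ad, negPf bc, negPf bd, negPf cd).
have [ga gb gc gd] : [/\ g a = p, g b = q, g c = r & g d = s] by case: g_new.
(* All five colors on the pentagon differ, which yields both properness there and odd colors at the
   new vertices. *)
have g_inj : {in [:: v; a; b; c; d] &, injective g}.
  have g_uniq : uniq (map g [:: v; a; b; c; d]) by move: un; rewrite -g_new.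
  move=> x y xn yn gxy; rewrite -(nth_index v xn) -(nth_index v yn).
  congr (nth v _ _); apply/eqP.
  rewrite -(nth_uniq (g v) _ _ g_uniq) ?size_map ?index_mem //.
  by rewrite !(nth_map v) ?index_mem // !nth_index // gxy.
have memS' x : x \in S :|: [set y in [:: a; b; c; d]] ->
    x \in S \/ x \in [:: a; b; c; d] by rewrite in_setU [x \in [set _ | _]]inE => /orP.
have new_pent x : x \in [:: a; b; c; d] -> x \in [:: v; a; b; c; d].
  by move=> xn; rewrite inE xn orbT.
have vpent : v \in [:: v; a; b; c; d] := mem_head _ _.
exists g; split.
  have neq x y : x \in [:: v; a; b; c; d] -> y \in [:: v; a; b; c; d] ->
      adj x y -> g x != g y.
    move=> xn yn; apply: contraTneq => /(g_inj _ _ xn yn)->.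
    by rewrite adj_irrefl.
  move=> x y /memS'[xS|xn] /memS'[yS|yn] xy.
  - by rewrite !gS // f_proper.
  - by apply: (neq _ _ _ _ xy); [rewrite (only x y xS yn xy) | exact: new_pent].
  - have yx : adj y x by rewrite adj_sym.
    by apply: (neq _ _ _ _ xy); [exact: new_pent | rewrite (only y x yS xn yx)].
  - by apply: (neq _ _ _ _ xy); exact: new_pent.
have [oa ob oc od] := odd_at_new g att.
move: un; rewrite -g_new /= !inE !negb_or => /and5P[/and4P[vva vvb vvc _] /and3P[_ ac _] /andP[_ bd] _ _].
move=> _ x /memS'[xS|xn]; last first.
  by move: xn; rewrite !inE => /or4P[] /eqP->; rewrite ?oa ?ob ?oc ?od.
have [->|xv] := eqVneq x v.
  have /existsP[j oj] := ps; apply/existsP; exists j.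
  by rewrite (nbr_count_root _ att) oddD ga gd (eq_nbr_count _ _ gS).
rewrite (@eq_odd_at _ _ g f _ S) => [|i]; first last.
  by rewrite (nbr_count_old _ att) // (eq_nbr_count _ _ gS).
(* [x] and [v] are two distinct vertices of [S], so the guard of the induction hypothesis holds. *)
apply: f_odd => //; rewrite (cardsD1 x) xS (cardsD1 v) !inE eq_sym xv.
by rewrite vS.
Qed.

(** * The odd chromatic number *)

Theorem proposition1p2 (G : sgraph) (hnontriv : 1 < #|G|) (hconn : connected G)
    (hblocks : forall H : subgraph G, block H -> isomorphic (graph_of H) C5) :
  odd_chromatic_number G = 5.
Proof.
have tree := pentagon_tree_setT hconn hblocks.
(* No vertex is isolated: an edge must leave [[set x]] on the way to any other vertex. So the
   oddness condition binds at every vertex. *)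
have nbr (x : G) : neighborhood x != set0.
  have [y] : exists y, y \in ~: [set x].
    by apply/set0Pn; rewrite -card_gt0 cardsC1 -subn1 subn_gt0.
  rewrite inE => yx; have [u [w [/set1P-> _ xw]]] := connect_exit (hconn.2 x y) (set11 x) yx.
  by apply/set0Pn; exists w; rewrite inE.
have class_count k (phi : {ffun G -> 'I_k}) x i :
    #|color_class phi i :&: neighborhood x| = nbr_count phi [set: G] x i.
  rewrite /nbr_count -sum1_card [LHS]big_mkcond [RHS]big_mkcond; apply: eq_bigr => y _.
  by rewrite !inE andbC; case: (_ && _).
rewrite /odd_chromatic_number; case: ex_minnP => m col_m min_m.
apply/eqP; rewrite eqn_leq; apply/andP; split.
  apply: min_m; have [f [f_proper f_odd]] := pentagon_tree_colorable tree.
  apply/existsP; exists [ffun x => f x]; apply/andP; split.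
    apply/forallP => i; apply/forall_inP => x; rewrite inE ffunE => /eqP fx.
    apply/forall_inP => y; rewrite inE ffunE => /eqP fy.
    by apply/negP => /f_proper; rewrite fx fy eqxx !inE; move/(_ isT isT).
  apply/forallP => x; apply/implyP => _.
  have cardT : 1 < #|[set: G]| by rewrite cardsT.
  have /existsP[i oi] := f_odd cardT x (in_setT x); apply/existsP; exists i; rewrite class_count.
  by rewrite (@eq_nbr_count _ _ _ f) // => y _; rewrite ffunE.
rewrite ltnNge; apply/negP => m4; case/existsP: col_m => phi /andP[/forallP phi_proper phi_odd].
have [|x _ /negP[]] := @pentagon_tree_not_odd G m phi _ m4 _ tree.
  move=> x y xy; apply/negP => /eqP phixy.
  have /forall_inP/(_ x) := phi_proper (phi x).
  rewrite inE eqxx => /(_ isT)/forall_inP/(_ y).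
  by rewrite inE phixy eqxx xy => /(_ isT).
have /implyP/(_ (nbr x))/existsP[i] := forallP phi_odd x.
by rewrite class_count => oi; apply/existsP; exists i.
Qed.
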